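(* Let $a_1,a_2,\dots,a_n$ be integers with $3\leq a_1\leq a_2\leq\dots\leq a_n$, and suppose that every number from the set $\{a_1,a_1+1,a_1+2,\dots,a_1^2-a_1-1\}$ occurs in the sequence $a_1,a_2,\dots,a_n$. Then $$g(a_1,a_2,\dots,a_n)=a_1-1.$$
   Context: For positive integers $a_1,\dots,a_n$ (repetitions allowed) with greatest common divisor $1$, the Frobenius number $g(a_1,\dots,a_n)$ is the greatest integer $b$ such that the equation $\sum_{i=1}^{n}a_ix_i=b$ has no solution in non-negative integers $x_1,\dots,x_n$. *)

(* Defs.v *)
From mathcomp Require Import all_boot all_order all_algebra.

Set Implicit Arguments.
Unset Strict Implicit.
Unset Printing Implicit Defensive.

Import Order.TTheory GRing.Theory Num.Theory.

Local Open Scope ring_scope.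

Definition representable (n : nat) (a : 'I_n -> int) (b : int) : Prop :=
  exists x : 'I_n -> nat, \sum_(i < n) a i * (x i)%:Z = b.

(* [is_frobenius_number a b] reads "g(a_1, ..., a_n) is defined and equals b".
   The first two components are the domain of g, the last two say that b is the
   greatest element of the set of all (possibly negative) integers that are not
   representable; such a b is unique. *)
Definition is_frobenius_number (n : nat) (a : 'I_n -> int) (b : int) : Prop :=
  [/\ forall i, 0 < a i,
      \big[gcdz/0]_(i < n) a i = 1,
      ~ representable a b
    & forall c : int, ~ representable a c -> c <= b].

(* Main.v *)
Require Import Defs.
From mathcomp Require Import all_boot all_order all_algebra.
From mathcomp Require Import zify.

(** Call the [a i] coins and put [m := a ord0], the least of them.  Since [3 <= m] we have
    [2 * m - 1 <= m ^ 2 - m - 1], so the coins include the whole block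
    [m, m + 1, ..., 2 * m - 1], a full residue system modulo [m] lying just above
    [m - 1].  Any [c >= m] is therefore a coin [m + c %% m] of that block plus
    some copies of [m], so [c] is representable ([representable_of_block]).
    On the other hand a non-zero combination is at least as large as the least
    coin, so [m - 1], which lies strictly between [0] and [m], is not
    representable ([representable_lower_bound]).  The gcd is [1] because two
    consecutive integers [m] and [m + 1] occur ([biggcdz_consecutive]). *)

Set Implicit Arguments.
Unset Strict Implicit.
Unset Printing Implicit Defensive.

Import Order.TTheory GRing.Theory Num.Theory.

Local Open Scope ring_scope.

(** As [gcdz 0 x] is [`|x|], the value [0] is not neutral for [gcdz] on [int], so
    the monoid lemmas on iterated operators do not apply: hence the induction on
    the index sequence. *)
Lemma biggcdz_dvd (I : eqType) (r : seq I) (F : I -> int) (j : I) :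
  j \in r -> (\big[gcdz/0]_(i <- r) F i %| F j)%Z.
Proof.
elim: r => [//|i r IHr]; rewrite inE big_cons => /predU1P[-> | /IHr dvd_Fj].
  exact: dvdz_gcdl.
exact: dvdz_trans (dvdz_gcdr _ _) dvd_Fj.
Qed.

Lemma biggcdz_ge0 (I : Type) (r : seq I) (F : I -> int) :
  0 <= \big[gcdz/0]_(i <- r) F i.
Proof. by case: r => [|i r]; rewrite ?big_nil ?big_cons. Qed.

Lemma biggcdz_consecutive (n : nat) (a : 'I_n -> int) (i j : 'I_n) :
  a j = a i + 1 -> \big[gcdz/0]_(k < n) a k = 1.
Proof.
move=> aj; set g := \big[_/_]_(k < n) _.
have g_dvd k : (g %| a k)%Z by apply: biggcdz_dvd; rewrite mem_index_enum.
have : (g %| a j - a i)%Z by rewrite rpredB ?g_dvd.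
have g_ge0 : 0 <= g := biggcdz_ge0 _ _.
by rewrite aj addrAC subrr add0r dvdz1 => /eqP g1; rewrite -(gez0_abs g_ge0) g1.
Qed.

Lemma representable_coin (n : nat) (a : 'I_n -> int) (i : 'I_n) (q : nat) :
  representable a (a i * q%:Z).
Proof.
exists (fun k => if k == i then q else 0%N).
rewrite (bigD1 i) //= eqxx big1 ?addr0 // => k /negPf->.
by rewrite mulr0.
Qed.

Lemma representableD (n : nat) (a : 'I_n -> int) (b c : int) :
  representable a b -> representable a c -> representable a (b + c).
Proof.
move=> [x <-] [y <-]; exists (fun k => (x k + y k)%N).
by rewrite -big_split; apply: eq_bigr => k _; rewrite PoszD mulrDr.
Qed.

(** As soon as some coefficient is non-zero, its single term already reaches the
    bound, and the other terms are non-negative. *)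
Lemma representable_lower_bound (n : nat) (a : 'I_n -> int) (m b : int) :
  0 <= m -> (forall i, m <= a i) -> representable a b -> b = 0 \/ m <= b.
Proof.
move=> m_ge0 m_le [x <-].
have [/existsP[i xi_neq0] | /existsPn x0] := boolP [exists i, x i != 0%N].
  right; rewrite (bigD1 i) //=.
  have rest_ge0 : 0 <= \sum_(k < n | k != i) a k * (x k)%:Z.
    by apply: sumr_ge0 => k _; rewrite mulr_ge0 // (le_trans m_ge0).
  have ai_le : a i <= a i * (x i)%:Z.
    by rewrite ler_peMr ?(le_trans m_ge0) // lez_nat lt0n.
  exact: le_trans (m_le i) (ler_wpDr rest_ge0 ai_le).
by left; apply: big1 => k _; move/negPn/eqP: (x0 k) => ->; rewrite mulr0.
Qed.

(** [m] consecutive coins starting at [m] cover every residue class modulo [m],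
    and adding copies of [m] reaches every larger member of each class. *)
Lemma representable_of_block (n : nat) (a : 'I_n -> int) (m c : int) :
    0 < m -> (forall k, m <= k < m *+ 2 -> exists i, a i = k) -> m <= c ->
  representable a c.
Proof.
move=> m_gt0 block m_le_c.
have r_ge0 : 0 <= (c %% m)%Z by rewrite modz_ge0 // gt_eqF.
have r_lt : (c %% m)%Z < m by rewrite ltz_pmod.
have [i0 ai0] : exists i, a i = m by apply: block; lia.
have [j aj] : exists j, a j = m + (c %% m)%Z by apply: block; lia.
(* One copy of [m] is spent inside the coin [m + c %% m]. *)
have q_gt0 : 0 < (c %/ m)%Z by have := divz_eq c m; nia.
have -> : c = a i0 * `|(c %/ m)%Z - 1|%N%:Z + a j * 1%N%:Z.
  by rewrite ai0 aj gez0_abs; have := divz_eq c m; lia.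
by apply: representableD; apply: representable_coin.
Qed.

Theorem theorem2p15 (n : nat) (a : 'I_n.+1 -> int)
  (a1_ge3 : 3 <= a ord0)
  (a_sorted : forall i j : 'I_n.+1, (i <= j)%N -> a i <= a j)
  (a_occurs : forall k : int,
     a ord0 <= k <= a ord0 ^+ 2 - a ord0 - 1 -> exists i : 'I_n.+1, a i = k) :
  is_frobenius_number a (a ord0 - 1).
Proof.
have a_min i : a ord0 <= a i by apply: a_sorted.
(* As [3 * m <= m ^ 2], the given interval reaches at least [2 * m - 1]. *)
have block k : a ord0 <= k < a ord0 *+ 2 -> exists i, a i = k.
  by move=> k_in; apply: a_occurs; rewrite expr2; nia.
split.
- by move=> i; have := a_min i; lia.
- have [j aj] : exists j, a j = a ord0 + 1 by apply: block; lia.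
  exact: biggcdz_consecutive aj.
- by case/(representable_lower_bound _ a_min); lia.
- move=> c c_nrep; rewrite leNgt; apply/negP => m_le_c.
  by apply/c_nrep/(representable_of_block _ block); lia.
Qed.
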